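(* Consider the multi-agent system $\dot{x} = (I_N\otimes A)x + (I_N\otimes B)u$, $x(0)=x_0$, with agent state matrices $A\in\mathbb{R}^{n\times n}$, $B\in\mathbb{R}^{n\times m}$, where the pair $(A,B)$ is stabilizable, and with given real weighting matrices $Q\ge 0$ (size $n\times n$) and $R>0$ (size $m\times m$). Assume that the underlying graph on $N$ nodes is undirected and connected, with Laplacian $L$ having eigenvalues $0=\lambda_1<\lambda_2\le\cdots\le\lambda_N$. For $K\in\mathbb{R}^{m\times n}$ let $$J(K)=\int_0^\infty x^\top\left(L\otimes Q+L^2\otimes K^\top R K\right)x\,dt$$ be the cost along the solution of the controlled network $\dot{x}=(I_N\otimes A+L\otimes BK)x$, $x(0)=x_0$. Let $\gamma>0$. Choose $c$ such that $$0<c<\frac{2}{\lambda_2+\lambda_N}.$$ Then there exists a positive semi-definite matrix $P$ satisfying the Riccati inequality $$A^\top P+PA+(c^2\lambda_2^2-2c\lambda_2)PBR^{-1}B^\top P+\lambda_N Q<0.$$ Assume, moreover, that a positive semi-definite $P$ satisfying this inequality can be found such that $$x_0^\top\left(\left(I_N-\frac1N\mathbf{1}_N\mathbf{1}_N^\top\right)\otimes P\right)x_0<\gamma.$$ Let $K:=-cR^{-1}B^\top P$. Then the controlled network $\dot{x}=(I_N\otimes A+L\otimes BK)x$ reaches consensus and the control law $u=(L\otimes K)x$ is suboptimal, i.e., $J(K)<\gamma$.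
   Context: Setting: there are $N\ge 2$ identical agents $\dot{x}_i=Ax_i+Bu_i$, $x_i(0)=x_{i0}$, $i=1,\dots,N$, with $x_i\in\mathbb{R}^n$, $u_i\in\mathbb{R}^m$; $x=(x_1^\top,\dots,x_N^\top)^\top\in\mathbb{R}^{nN}$, $u=(u_1^\top,\dots,u_N^\top)^\top\in\mathbb{R}^{mN}$, and $x_0=(x_{10}^\top,\dots,x_{N0}^\top)^\top$ is given. A distributed control law is $u=(L\otimes K)x$ with a common gain $K\in\mathbb{R}^{m\times n}$; interconnecting it with the agents gives the controlled network $\dot{x}=(I_N\otimes A+L\otimes BK)x$. The pair $(A,B)$ is stabilizable if there is a real $F$ with $A+BF$ Hurwitz (all eigenvalues have negative real part). Consensus: the controlled network reaches consensus if for all $i,j=1,\dots,N$ and for all initial conditions on $x_i$ and $x_j$ one has $x_i(t)-x_j(t)\to 0$ as $t\to\infty$. Notation: for a real symmetric matrix $P$, $P>0$ ($P\ge 0$) means positive definite (positive semi-definite), $P<0$ means $-P>0$; positive semi-definite matrices are real symmetric. $I_k$ is the $k\times k$ identity, $\mathbf{1}_N\in\mathbb{R}^N$ is the all-ones vector, $\otimes$ is the Kronecker product. The graph Laplacian is $L=D-\mathcal{A}$ with $\mathcal{A}$ the (0/1) adjacency matrix and $D$ the diagonal degree matrix. *)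

(* Defs.v *)
From HB Require Import structures.
From mathcomp Require Import all_boot all_order all_algebra.
From mathcomp Require Import all_classical all_reals all_analysis.
From mathcomp Require Import complex mxtens.

Set Implicit Arguments.
Unset Strict Implicit.
Unset Printing Implicit Defensive.

Import Order.TTheory GRing.Theory Num.Theory.
Import numFieldNormedType.Exports.

Local Open Scope classical_set_scope.
Local Open Scope ring_scope.

Definition quad (R : realType) (n : nat) (P : 'M[R]_n) (v : 'cV[R]_n) : R :=
  (v^T *m P *m v) ord0 ord0.

Definition possemidef (R : realType) (n : nat) (P : 'M[R]_n) : Prop :=
  P^T = P /\ forall v : 'cV[R]_n, 0 <= quad P v.

Definition posdef (R : realType) (n : nat) (P : 'M[R]_n) : Prop :=
  P^T = P /\ forall v : 'cV[R]_n, v != 0 -> 0 < quad P v.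

Definition negdef (R : realType) (n : nat) (P : 'M[R]_n) : Prop :=
  posdef (- P).

(* The eigenvalues are the complex ones, so the real matrix is first mapped
   to R[i]. *)
Definition hurwitz (R : realType) (n : nat) (M : 'M[R]_n) : Prop :=
  forall z : R[i], eigenvalue (map_mx (real_complex R) M) z -> complex.Re z < 0.

Definition stabilizable (R : realType) (n m : nat)
    (A : 'M[R]_n) (B : 'M[R]_(n, m)) : Prop :=
  exists F : 'M[R]_(m, n), hurwitz (A + B *m F).

(* A graph on N nodes is its adjacency relation on 'I_N. *)
Definition simple_undirected (N : nat) (e : rel 'I_N) : Prop :=
  symmetric e /\ irreflexive e.

Definition connected_graph (N : nat) (e : rel 'I_N) : Prop :=
  forall i j : 'I_N, connect e i j.

Definition adjacency (R : realType) (N : nat) (e : rel 'I_N) : 'M[R]_N :=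
  \matrix_(i, j) (e i j)%:R.

Definition degree (R : realType) (N : nat) (e : rel 'I_N) : 'M[R]_N :=
  diag_mx (\row_i #|[set j | e i j]%SET|%:R).

Definition laplacian (R : realType) (N : nat) (e : rel 'I_N) : 'M[R]_N :=
  degree R e - adjacency R e.

(* lam lists all eigenvalues of M, with algebraic multiplicity, in
   nondecreasing order; indices start at 0, so the k-th smallest one is
   lam`_k.-1. *)
Definition ordered_spectrum (R : realType) (N : nat) (M : 'M[R]_N)
    (lam : N.-tuple R) : Prop :=
  sorted <=%R lam /\ char_poly M = \prod_(l <- lam) ('X - l%:P).

(* x solves dx/dt = M x on [0, +oo[ with x(0) = x0; the values of x at
   negative times are irrelevant, hence continuity only from the right at 0. *)
Definition is_solution (R : realType) (d : nat) (M : 'M[R]_d) (x0 : 'cV[R]_d)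
    (x : R -> 'cV[R]_d) : Prop :=
  [/\ x 0 = x0,
      {within `[0%R, +oo[, continuous x} &
      forall t : R, 0 < t -> is_derive t 1 x (M *m x t)].

(* In the stacked vector of all agent states, the component k of agent i has
   index mxtens_index (i, k), the indexing used by the Kronecker product *t. *)
Definition agent (R : realType) (N n : nat) (x : 'cV[R]_(N * n)) (i : 'I_N) :
    'cV[R]_n :=
  \col_k x (mxtens_index (i, k)) ord0.

Definition closed_loop (R : realType) (N n m : nat) (A : 'M[R]_n)
    (B : 'M[R]_(n, m)) (L : 'M[R]_N) (K : 'M[R]_(m, n)) : 'M[R]_(N * n) :=
  1%:M *t A + L *t (B *m K).

Definition reaches_consensus (R : realType) (N n : nat) (M : 'M[R]_(N * n)) :
    Prop :=
  forall (x0 : 'cV[R]_(N * n)) (x : R -> 'cV[R]_(N * n)),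
    is_solution M x0 x ->
    forall i j : 'I_N, agent (x t) i - agent (x t) j @[t --> +oo] --> (0 : 'cV[R]_n).

(* The cost of a trajectory, an extended real: the integrand is nonnegative
   but the integral may diverge. *)
Definition cost (R : realType) (N n m : nat) (L : 'M[R]_N) (Q : 'M[R]_n)
    (W : 'M[R]_m) (K : 'M[R]_(m, n)) (x : R -> 'cV[R]_(N * n)) : \bar R :=
  (\int[@lebesgue_measure R]_(t in `[0%R, +oo[)
     (quad (L *t Q + (L *m L) *t (K^T *m W *m K)) (x t))%:E)%E.

(* The solution of the controlled network issued from x0 exists and is unique
   on [0, +oo[, so the quantification over x selects that solution. *)
Definition suboptimal (R : realType) (N n m : nat) (A : 'M[R]_n)
    (B : 'M[R]_(n, m)) (L : 'M[R]_N) (Q : 'M[R]_n) (W : 'M[R]_m)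
    (x0 : 'cV[R]_(N * n)) (gamma : R) (K : 'M[R]_(m, n)) : Prop :=
  forall x : R -> 'cV[R]_(N * n),
    is_solution (closed_loop A B L K) x0 x ->
    (cost L Q W K x < gamma%:E)%E.

Definition riccati_ineq (R : realType) (n m : nat) (A : 'M[R]_n)
    (B : 'M[R]_(n, m)) (Q : 'M[R]_n) (W : 'M[R]_m) (c lam2 lamN : R)
    (P : 'M[R]_n) : Prop :=
  negdef (A^T *m P + P *m A
          + (c ^+ 2 * lam2 ^+ 2 - 2 * c * lam2)
              *: (P *m B *m invmx W *m B^T *m P)
          + lamN *: Q).

(* I_N - (1/N) 1_N 1_N^T *)
Definition centering (R : realType) (N : nat) : 'M[R]_N :=
  1%:M - N%:R^-1 *: ((const_mx 1 : 'cV[R]_N) *m (const_mx 1 : 'cV[R]_N)^T).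

(* Main.v *)
Require Import Defs.
From HB Require Import structures.
From mathcomp Require Import all_boot all_order all_algebra.
From mathcomp Require Import all_classical all_reals all_analysis.
From mathcomp Require Import complex mxtens.
From mathcomp Require Import measurable_realfun ring lra zify.

Set Implicit Arguments.
Unset Strict Implicit.
Unset Printing Implicit Defensive.

Import Order.TTheory GRing.Theory Num.Theory.
Import numFieldNormedType.Exports.

Local Open Scope classical_set_scope.
Local Open Scope ring_scope.

(** Let L be the Laplacian, C the centering matrix, G = P B W^-1 B^T P, and
    K = - c W^-1 B^T P the gain. Everything is read off the single function
    V(x) = x^T (C (x) P) x, which measures disagreement between the agents.

    The Laplacian is symmetric, so the stacked state splits into modes z_k, one
    for each Laplacian eigenvalue d_k, and every Kronecker quadratic form that
    occurs is a sum over k of a weight depending on d_k times a form in z_k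
    ([quad_tens_modes]). The matrix C has the same eigenvectors: it kills the
    modes with d_k = 0, where z_k is the average of the agents up to a factor,
    and fixes all others, for which lambda_2 <= d_k <= lambda_N
    ([laplacian_centering_modes], the place where connectedness enters).
    Along a solution, the derivative of V plus the running cost is
    the sum over the modes with d_k <> 0 of
      z_k^T (A^T P + P A + (c^2 d_k^2 - 2 c d_k) G + d_k Q) z_k.
    The parabola c^2 d^2 - 2 c d lies on [lambda_2, lambda_N] below its value
    at lambda_2, because c (d + lambda_2) <= c (lambda_2 + lambda_N) < 2. So the
    Riccati inequality bounds the sum by - kappa V for some kappa > 0
    ([dissipation]). Hence V decays exponentially, which is consensus
    since P is positive definite ([riccati_posdef], [agent_diff_le]), and the
    cost is at most the integral of - dV/dt, which is V(x_0) < gamma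
    ([dissipated_integral]).

    A solution of the Riccati inequality is obtained without the algebraic
    Riccati equation. If A + B F is Hurwitz, it has a Lyapunov matrix P_0
    ([lyapunov]), and a large multiple tau P_0 works ([riccati_solvable]):
    the coefficient c^2 lambda_2^2 - 2 c lambda_2 is negative, so completing the
    square in the terms that contain F bounds the left-hand side by
    tau ((A + B F)^T P_0 + P_0 (A + B F)) plus a matrix of order 1. The Lyapunov
    matrix comes from the complex Schur form by a diagonal weighting. *)

(** * Quadratic forms *)

Section QuadraticForms.
Variables (R : realType).

Lemma quadD n (S T : 'M[R]_n) v : quad (S + T) v = quad S v + quad T v.
Proof. by rewrite /quad mulmxDr mulmxDl mxE. Qed.

Lemma quadN n (S : 'M[R]_n) v : quad (- S) v = - quad S v.
Proof. by rewrite /quad mulmxN mulNmx mxE. Qed.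

Lemma quadZ n a (S : 'M[R]_n) v : quad (a *: S) v = a * quad S v.
Proof. by rewrite /quad -scalemxAr -scalemxAl mxE. Qed.

Lemma quad_vec0 n (S : 'M[R]_n) : quad S 0 = 0.
Proof. by rewrite /quad mulmx0 mxE. Qed.

Lemma quad_vecZ n (S : 'M[R]_n) a v : quad S (a *: v) = a ^+ 2 * quad S v.
Proof.
by rewrite /quad !linearZ /= -!scalemxAl scalerA mxE expr2.
Qed.

Lemma quad_congr m n (S : 'M[R]_m) (G : 'M[R]_(m, n)) v :
  quad (G^T *m S *m G) v = quad S (G *m v).
Proof. by rewrite /quad trmx_mul !mulmxA. Qed.

Lemma quad_trmx n (S : 'M[R]_n) v : quad S^T v = quad S v.
Proof.
have trE (B : 'M[R]_1) : B ord0 ord0 = B^T ord0 ord0 by rewrite mxE.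
by rewrite /quad trE !trmx_mul !trmxK mulmxA.
Qed.

Lemma quad_diag n (d : 'rV[R]_n) v :
  quad (diag_mx d) v = \sum_i d 0 i * v i 0 ^+ 2.
Proof.
rewrite /quad mxE; apply: eq_bigr => i _.
by rewrite mul_mx_diag !mxE expr2 mulrA (mulrC (d 0 i)).
Qed.

Lemma quad1E n (v : 'cV[R]_n) : quad 1%:M v = \sum_i v i 0 ^+ 2.
Proof. by rewrite /quad mulmx1 mxE; apply: eq_bigr => i _;
  rewrite mxE expr2. Qed.

Lemma quad1_ge0 n (v : 'cV[R]_n) : 0 <= quad 1%:M v.
Proof. by rewrite quad1E sumr_ge0 // => i _; exact: sqr_ge0. Qed.

Lemma quad1_eq0 n (v : 'cV[R]_n) : (quad 1%:M v == 0) = (v == 0).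
Proof.
rewrite quad1E; apply/eqP/eqP => [/psumr_eq0P v0|->].
  apply/colP => i; rewrite mxE; apply/eqP.
  by rewrite -sqrf_eq0 v0 // => j _; exact: sqr_ge0.
by rewrite big1 // => i _; rewrite mxE expr0n.
Qed.

Lemma quad1_gt0 n (v : 'cV[R]_n) : (0 < quad 1%:M v) = (v != 0).
Proof. by rewrite lt0r quad1_eq0 quad1_ge0 andbT. Qed.

Lemma posdef_ge0 n (S : 'M[R]_n) v : posdef S -> 0 <= quad S v.
Proof.
case=> _ S0; have [->|v0] := eqVneq v 0; first by rewrite quad_vec0.
by rewrite ltW // S0.
Qed.

Lemma posdef_unit n (S : 'M[R]_n) : posdef S -> S \in unitmx.
Proof.
case=> Ssym S0; rewrite -row_free_unit -kermx_eq0; apply/negPn/negP.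
move=> /rowV0Pn[v /sub_kermxP vS v0].
have vT0 : v^T != 0 by apply: contraNneq v0 => /(congr1 trmx);
  rewrite trmxK trmx0 => ->.
by have := S0 _ vT0; rewrite /quad trmxK vS mul0mx mxE ltxx.
Qed.

End QuadraticForms.

(** * Orthogonal diagonalization of real symmetric matrices *)

Section RealSpectral.
Variable R : realType.
Local Notation toC := (real_complex R).
Local Notation Cx := (map_mx toC).

Lemma Re_mulmx m n p (Z : 'M[R[i]]_(m, n)) (M : 'M[R]_(n, p)) :
  map_mx (@complex.Re R) (Z *m Cx M) = map_mx (@complex.Re R) Z *m M.
Proof.
apply/matrixP => i j; rewrite !mxE (raddf_sum (@complex.Re R
  : Rcomplex R -> R)).
by apply: eq_bigr => k _; rewrite !mxE; case: (Z i k) => a b /=;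
  rewrite mulr0 subr0.
Qed.

Lemma Im_mulmx m n p (Z : 'M[R[i]]_(m, n)) (M : 'M[R]_(n, p)) :
  map_mx (@complex.Im R) (Z *m Cx M) = map_mx (@complex.Im R) Z *m M.
Proof.
apply/matrixP => i j; rewrite !mxE (raddf_sum (@complex.Im R
  : Rcomplex R -> R)).
by apply: eq_bigr => k _; rewrite !mxE; case: (Z i k) => a b /=;
  rewrite mulr0 add0r mulrC.
Qed.

(** A complex eigenvector x + i y for a + i b exists. Comparing x M y^T with
    its transpose y M x^T gives b (|x|^2 + |y|^2) = 0, so the eigenvalue is real
    and x or y is a real eigenvector. *)
Lemma sym_real_eigenvector n (M : 'M[R]_n.+1) : M^T = M ->
  exists a, exists2 v : 'rV[R]_n.+1, v != 0 & v *m M = a *: v.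
Proof.
move=> Msym.
have [z /eigenvalueP[v vM v0]] := eigenvalue_closed (Cx M) (ltn0Sn n).
case: z vM => a b vM.
pose x := map_mx (@complex.Re R) v; pose y := map_mx (@complex.Im R) v.
have xM : x *m M = a *: x - b *: y.
  rewrite -Re_mulmx vM; apply/rowP => j; rewrite !mxE.
  by case: (v 0 j).
have yM : y *m M = b *: x + a *: y.
  rewrite -Im_mulmx vM; apply/rowP => j; rewrite !mxE.
  by case: (v 0 j) => ? ? /=; rewrite addrC.
have xy0 : 0 < quad 1%:M x^T + quad 1%:M y^T.
  rewrite lt0r addr_ge0 ?quad1_ge0 // andbT paddr_eq0 ?quad1_ge0 // !quad1_eq0.
  apply: contraNN v0 => /andP[/eqP x0 /eqP y0].
  apply/eqP/rowP => j; rewrite mxE.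
  have /colP/(_ j) := x0; have /colP/(_ j) := y0; rewrite !mxE.
  by case: (v 0 j) => ? ? /= -> ->.
have b0 : b = 0.
  have : x *m M *m y^T = (y *m M *m x^T)^T
    by rewrite !trmx_mul trmxK Msym mulmxA.
  rewrite xM yM mulmxBl mulmxDl linearD /= -!scalemxAl !linearZ /= !trmx_mul
    !trmxK.
  rewrite addrC => /addIr.
  have -> : y *m y^T = (quad 1%:M y^T)%:M
    by rewrite [LHS]mx11_scalar /quad trmxK mulmx1.
  have -> : x *m x^T = (quad 1%:M x^T)%:M
    by rewrite [LHS]mx11_scalar /quad trmxK mulmx1.
  move=> /matrixP /(_ 0 0); rewrite !mxE /= !mulr1n => /eqP.
  rewrite mulrN eq_sym -addr_eq0 -mulrDr mulf_eq0 => /orP[/eqP //|].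
  by rewrite gt_eqF.
move: xM yM; rewrite b0 !scale0r subr0 add0r => xM yM.
exists a; have [x0|x0] := eqVneq x 0; last by exists x.
exists y => //; apply: contraTneq xy0 => y0.
by rewrite x0 y0 trmx0 quad_vec0 addr0 ltxx.
Qed.

(** The Householder reflection along e_0 - v exchanges e_0 and the unit
    vector v. *)
Lemma householder n (v : 'rV[R]_n.+1) : v *m v^T = 1%:M ->
  exists H : 'M[R]_n.+1, [/\ H^T = H, H *m H = 1%:M & row 0 H = v].
Proof.
move=> vv; pose e := delta_mx 0 0 : 'rV[R]_n.+1.
have ee : e *m e^T = 1%:M.
  by rewrite trmx_delta mul_delta_mx; apply/matrixP => i j; rewrite !ord1 !mxE.
pose w := e - v; pose s := (w *m w^T) 0 0.
have [s0|s0] := eqVneq s 0.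
  exists 1%:M; split; rewrite ?trmx1 ?mulmx1 //.
  have /eqP : quad 1%:M w^T = 0 by rewrite /quad trmxK mulmx1.
  rewrite quad1_eq0 => /eqP/(congr1 trmx); rewrite trmxK trmx0 => /eqP.
  by rewrite subr_eq0 => /eqP <-; rewrite row1.
pose H := 1%:M - (2 / s) *: (w^T *m w) : 'M[R]_n.+1.
have ww : w *m w^T = s%:M by rewrite [LHS]mx11_scalar.
exists H; split.
- by rewrite linearB /= linearZ /= trmx_mul trmxK trmx1.
- have XX : w^T *m w *m (w^T *m w) = s *: (w^T *m w).
    by rewrite mulmxA -(mulmxA w^T) ww mul_mx_scalar -scalemxAl.
  rewrite mulmxBl mul1mx mulmxBr mulmx1 -scalemxAl -scalemxAr XX !scalerA.
  have -> : 2 / s * (2 / s) * s = 2 / s + 2 / s by field.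
  by rewrite scalerDl opprB addrK subrK.
- have ew : 2 *: (e *m w^T) = s%:M.
    rewrite -ww /w linearB /= !mulmxBl !mulmxBr ee vv.
    have -> : v *m e^T = e *m v^T.
      by rewrite -[LHS]trmxK trmx_mul trmxK [e *m _]mx11_scalar tr_scalar_mx.
    by rewrite opprB scaler_nat mulr2n.
  rewrite rowE -/e mulmxBr mulmx1 -scalemxAr mulmxA.
  have -> : 2 / s = s^-1 * 2 by rewrite mulrC.
  by rewrite -scalerA scalemxAl ew mul_scalar_mx scalerA mulVf // scale1r opprB
    addrC subrK.
Qed.

(** Induction on the size: conjugating by a reflection that takes e_0 to a unit
    eigenvector leaves a symmetric block matrix diag(a, M'). *)
Theorem sym_orthogonal_diag n (M : 'M[R]_n) : M^T = M ->
  exists (U : 'M[R]_n) (d : 'rV[R]_n),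
    [/\ U^T *m U = 1%:M, U *m U^T = 1%:M & M = U^T *m diag_mx d *m U].
Proof.
elim: n M => [|n IHn] M Msym.
  by exists 1%:M, 0; split; apply/matrixP => -[].
have [a [v0 v0_neq0 v0M]] := sym_real_eigenvector Msym.
pose r := Num.sqrt (quad 1%:M v0^T); pose v := r^-1 *: v0.
have r_gt0 : 0 < r by rewrite sqrtr_gt0 quad1_gt0 -trmx0 (inj_eq trmx_inj).
have vM : v *m M = a *: v by rewrite -scalemxAl v0M !scalerA mulrC.
have vv : v *m v^T = 1%:M.
  rewrite linearZ /= -scalemxAl -scalemxAr scalerA [_ *m _]mx11_scalar.
  have -> : (v0 *m v0^T) 0 0 = r ^+ 2.
    by rewrite sqr_sqrtr ?quad1_ge0 // /quad trmxK mulmx1.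
  by rewrite scale_scalar_mx; congr (_%:M); field; exact: lt0r_neq0.
have [H [Hsym HH H0]] := householder vv.
pose M1 : 'M[R]_(1 + n) := H *m M *m H.
have M1sym : M1^T = M1 by rewrite !trmx_mul Hsym Msym mulmxA.
have M1row : row 0 M1 = a *: delta_mx 0 0.
  by rewrite !row_mul H0 vM -H0 -scalemxAl -row_mul HH row1.
have M1def : M = H *m M1 *m H by rewrite /M1 !mulmxA HH mul1mx -mulmxA HH
  mulmx1.
clearbody M1.
have M1E : M1 = block_mx a%:M 0 0 (drsubmx M1).
  have M1u j : M1 0 j = a * (j == 0)%:R.
    by have /rowP/(_ j) := M1row; rewrite !mxE.
  have ur : ursubmx M1 = 0.
    apply/matrixP => i j; rewrite !mxE (ord1 i).
    have -> : lshift n 0 = 0 :> 'I_(1 + n) by apply: val_inj.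
    by rewrite M1u mulr0.
  rewrite -[LHS]submxK ur -[dlsubmx M1]trmxK trmx_dlsub M1sym ur trmx0.
  congr block_mx; apply/matrixP => i j; rewrite !mxE !ord1.
  have -> : lshift n 0 = 0 :> 'I_(1 + n) by apply: val_inj.
  by rewrite M1u mulr1 mulr1n.
have [|V [d [VV VV' M1d]]] := IHn (drsubmx M1).
  by rewrite trmx_drsub M1sym.
pose V1 : 'M[R]_(1 + n) := block_mx 1%:M 0 0 V.
have V1T : V1^T = block_mx 1%:M 0 0 V^T by rewrite tr_block_mx trmx1 !trmx0.
have V1V1 : V1^T *m V1 = 1%:M.
  by rewrite V1T mulmx_block !(mulmx0, mul0mx, mulmx1, addr0, add0r) VV
    -scalar_mx_block.
have V1V1' : V1 *m V1^T = 1%:M.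
  by rewrite V1T mulmx_block !(mulmx0, mul0mx, mulmx1, addr0, add0r) VV'
    -scalar_mx_block.
exists (V1 *m H), (row_mx a%:M d : 'rV[R]_(1 + n)); split.
- by rewrite trmx_mul Hsym mulmxA -(mulmxA H) V1V1 mulmx1 HH.
- by rewrite trmx_mul Hsym mulmxA -(mulmxA V1) HH mulmx1 V1V1'.
- have M1VdV : M1 = V1^T *m diag_mx (row_mx a%:M d) *m V1.
    have -> : diag_mx (row_mx a%:M d) = block_mx a%:M 0 0 (diag_mx d) :>
      'M[R]_(1 + n).
      rewrite diag_mx_row; congr block_mx.
      by apply/matrixP => i j; rewrite !ord1 !mxE.
    rewrite V1T /V1 !mulmx_block !(mulmx0, mul0mx, mulmx1, mul1mx, addr0,
      add0r).
    by rewrite -M1d -M1E.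
  by rewrite M1def M1VdV trmx_mul Hsym !mulmxA.
Qed.

End RealSpectral.

(** * Definite matrices under perturbation *)

Section Perturbation.
Variables (R : realType) (n : nat).
Implicit Types (S M : 'M[R]_n) (v : 'cV[R]_n).

Lemma quad1_orthogonal (U : 'M[R]_n) v : U^T *m U = 1%:M ->
  quad 1%:M (U *m v) = quad 1%:M v.
Proof. by move=> UU; rewrite -quad_congr mulmx1 UU. Qed.

Lemma sym_quad_le S : S^T = S ->
  exists2 s, 0 < s & forall v, quad S v <= s * quad 1%:M v.
Proof.
move=> /sym_orthogonal_diag[U [d [UU _ ->]]].
exists (1 + \sum_i `|d 0 i|) => [|v].
  by rewrite ltr_pwDl // sumr_ge0.
rewrite quad_congr quad_diag -(quad1_orthogonal v UU) quad1E mulr_sumr.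
apply: ler_sum => i _; rewrite ler_wpM2r ?sqr_ge0 //.
rewrite (le_trans (ler_norm _)) // (bigD1 i) //= addrCA lerDl.
by rewrite addr_ge0 // sumr_ge0.
Qed.

Lemma posdef_coercive M : posdef M ->
  exists2 p, 0 < p & forall v, p * quad 1%:M v <= quad M v.
Proof.
move=> [/sym_orthogonal_diag[U [d [UU UU' MUd]]] M0].
have d_gt0 i : 0 < d 0 i.
  have := M0 (U^T *m delta_mx i 0).
  rewrite MUd quad_congr mulmxA UU' mul1mx quad_diag (bigD1 i) //= big1 =>
    [|j ji].
    rewrite !mxE !eqxx expr1n mulr1 addr0; apply.
    apply/eqP => /(congr1 (mulmx U)); rewrite mulmxA UU' mul1mx mulmx0.
    by move=> /colP/(_ i)/eqP; rewrite !mxE !eqxx oner_eq0.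
  by rewrite !mxE (negbTE ji) expr0n mulr0.
exists (\big[Num.min/1]_i d 0 i) => [|v].
  by apply/bigmin_gtP; split.
rewrite MUd quad_congr quad_diag -(quad1_orthogonal v UU) quad1E mulr_sumr.
apply: ler_sum => i _; rewrite ler_wpM2r ?sqr_ge0 //.
exact: bigmin_le.
Qed.

(** Gives the step of the Riccati construction and the decay rate of the
    disagreement. *)
Lemma posdef_perturb M S : posdef M -> S^T = S ->
  exists2 del, 0 < del & posdef (M - del *: S).
Proof.
move=> Mpos Ssym; have [p p0 Mp] := posdef_coercive Mpos.
have [s s0 Ss] := sym_quad_le Ssym.
have del0 : 0 < p / (2 * s) by rewrite divr_gt0 // mulr_gt0.
exists (p / (2 * s)) => //; split=> [|v v0].
  by rewrite linearB /= linearZ /= Ssym Mpos.1.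
rewrite quadD quadN quadZ subr_gt0.
apply: le_lt_trans (ler_wpM2l (ltW del0) (Ss v)) _.
apply: lt_le_trans (Mp v).
have -> : p / (2 * s) * (s * quad 1%:M v) = p / 2 * quad 1%:M v.
  by field; rewrite lt0r_neq0.
by rewrite ltr_pM2r ?quad1_gt0 // ltr_pdivrMr // ltr_pMr // ltr1n.
Qed.

End Perturbation.

(** * The Lyapunov inequality *)

Lemma char_poly_conj (F : comNzRingType) n (P P' A : 'M[F]_n) :
  P *m P' = 1%:M -> char_poly (P *m A *m P') = char_poly A.
Proof.
move=> PP'; rewrite /char_poly /char_poly_mx.
have -> : 'X%:M - map_mx polyC (P *m A *m P') =
    map_mx polyC P *m ('X%:M - map_mx polyC A) *m map_mx polyC P'.
  rewrite !map_mxM mulmxBr mulmxBl; congr (_ - _).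
  by rewrite mul_mx_scalar -scalemxAl -map_mxM PP' map_mx1 scalemx1.
by rewrite !det_mulmx mulrAC -det_mulmx -map_mxM PP' map_mx1 det1 mul1r.
Qed.

Section Lyapunov.
Variable R : realType.
Local Notation toC := (real_complex R).
Local Notation Cx := (map_mx toC).

(** The inner product of the real plane underlying the complex numbers. *)
Definition redot (z y : R[i]) : R :=
  complex.Re z * complex.Re y + complex.Im z * complex.Im y.

Lemma redotD z y1 y2 : redot z (y1 + y2) = redot z y1 + redot z y2.
Proof. by case: y1 y2 => [a b] [a' b']; rewrite /redot /=; ring. Qed.

Lemma redot_ge0 z : 0 <= redot z z.
Proof. by rewrite /redot -!expr2 addr_ge0 // sqr_ge0. Qed.

Lemma redot_gt0 z : z != 0 -> 0 < redot z z.
Proof.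
case: z => a b; rewrite eq_complex /redot /= -!expr2 => ab0.
rewrite lt0r addr_ge0 ?sqr_ge0 // andbT paddr_eq0 ?sqr_ge0 //.
by rewrite !sqrf_eq0.
Qed.

Lemma weighted_redot_gt0 n (d : 'I_n -> R) (w : 'cV[R[i]]_n) :
  (forall i, 0 < d i) -> w != 0 -> 0 < \sum_i d i * redot (w i 0) (w i 0).
Proof.
move=> d0 w0; have [i wi0] : exists i, w i 0 != 0.
  apply/existsP; apply: contraNT w0 => /existsPn w0.
  by apply/eqP/colP => i; rewrite mxE; have /negPn/eqP := w0 i.
rewrite (bigD1 i) //= ltr_pwDl ?mulr_gt0 ?redot_gt0 // sumr_ge0 // => j _.
by rewrite mulr_ge0 ?redot_ge0 // ltW.
Qed.

(** A triangular matrix is dissipative for a suitable weighted norm as soon as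
    its diagonal is. In the induction the new coordinate u only feeds the
    others; the resulting cross terms cost half of the margin eta of the smaller
    block plus a multiple K of |u|^2, which a large weight on u absorbs. *)
Lemma trig_dissipative n (T : 'M[R[i]]_n) : is_trig_mx T ->
  (forall i, complex.Re (T i i) < 0) ->
  exists (d : 'I_n -> R) (eta : R), [/\ 0 < eta, forall i, 0 < d i &
    forall w : 'cV[R[i]]_n, \sum_i d i * redot (w i 0) ((T *m w) i 0)
       <= - eta * \sum_i redot (w i 0) (w i 0)].
Proof.
elim: n T => [|n IHn] T /is_trig_mxP Ttrig Tre.
  by exists (fun=> 1), 1; split=> // w; rewrite !big_ord0 mulr0.
pose T' := \matrix_(i, j) T (lift ord0 i) (lift ord0 j).
have [||d [eta [eta0 d0 dT']]] := IHn T'.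
- by apply/is_trig_mxP => i j ij; rewrite mxE Ttrig.
- by move=> i; rewrite mxE.
pose b i := T (lift ord0 i) ord0.
pose K := \sum_i (d i ^+ 2 / (2 * eta)) * redot (b i) (b i).
have K0 : 0 <= K.
  by rewrite sumr_ge0 // => i _; rewrite mulr_ge0 ?redot_ge0 // divr_ge0
    ?sqr_ge0 // mulr_ge0 // ltW.
pose a := T ord0 ord0.
have a0 : 0 < - complex.Re a by rewrite oppr_gt0 Tre.
(* The weight that turns the damping of u into exactly - (K + eta / 2). *)
pose d00 := (K + eta / 2) / (- complex.Re a).
have d000 : 0 < d00 by rewrite divr_gt0 // ltr_wpDl // divr_gt0.
exists (fun i => oapp d d00 (unlift ord0 i)), (eta / 2); split.
- by rewrite divr_gt0.
- by move=> i; case: unliftP => [j|] _ /=.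
move=> w; pose w' := \col_i w (lift ord0 i) 0; pose u := w ord0 0.
rewrite !big_ord_recl /= unlift_none /=.
under eq_bigr do rewrite liftK /=.
have -> : (T *m w) ord0 0 = a * u.
  rewrite mxE big_ord_recl big1 ?addr0 // => i _.
  by rewrite Ttrig ?mul0r.
have Tw i : (T *m w) (lift ord0 i) 0 = b i * u + (T' *m w') i 0.
  rewrite !mxE big_ord_recl; congr (_ + _).
  by apply: eq_bigr => j _; rewrite !mxE.
under eq_bigr do rewrite Tw redotD mulrDr.
rewrite big_split /=.
have /= := dT' w'.
under eq_bigr do rewrite [w' _ _]mxE.
under [X in _ <= _ * X]eq_bigr do rewrite [w' _ _]mxE.
set S3 := \sum_i _; set S4 := \sum_i _ => S34.
have S2 : \sum_i d i * redot (w (lift ord0 i) 0) (b i * u) <=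
    eta / 2 * S4 + K * redot u u.
  rewrite /S4 /K mulr_sumr mulr_suml -big_split; apply: ler_sum => i _ /=.
  have young x y : d i * (x * y) <= eta / 2 * x ^+ 2
      + d i ^+ 2 / (2 * eta) * y ^+ 2.
    rewrite -subr_ge0.
    have -> : eta / 2 * x ^+ 2 + d i ^+ 2 / (2 * eta) * y ^+ 2 - d i * (x * y) =
              (eta * x - d i * y) ^+ 2 / (2 * eta) by field; exact: lt0r_neq0.
    by rewrite divr_ge0 ?sqr_ge0 // mulr_ge0 // ltW.
  rewrite -[X in _ <= _ + X]mulrA.
  have -> : redot (b i) (b i) * redot u u = redot (b i * u) (b i * u).
    by rewrite /redot; case: (b i) (u) => [a1 a2] [u1 u2] /=; ring.
  rewrite /redot -!expr2 !mulrDr addrACA.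
  exact: lerD (young _ _) (young _ _).
have -> : redot u (a * u) = complex.Re a * redot u u.
  by rewrite /redot; case: (a) (u) => [a1 a2] [u1 u2] /=; ring.
have -> : d00 * (complex.Re a * redot u u) = - (K + eta / 2) * redot u u.
  by rewrite /d00; field; have := lt0r_neq0 a0; rewrite ?oppr_eq0.
have := redot_ge0 u; nra.
Qed.

(** With S M S^-1 triangular and the weights d of [trig_dissipative], the form
    v |-> sum_i d_i |(S v)_i|^2 decreases along M; on real v it is the form of
    the real matrix P below. *)
Lemma lyapunov n (M : 'M[R]_n) : hurwitz M ->
  exists2 P, posdef P & negdef (M^T *m P + P *m M).
Proof.
case: n M => [|n] M Mhur.
  have posdef0 (S : 'M[R]_0) : posdef S.
    by split=> [|v]; [apply/matrixP => -[] | rewrite flatmx0 eqxx].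
  by exists 0; exact: posdef0.
have [S /unitarymx_unit Sunit] := Schur (Cx M) (ltn0Sn n).
rewrite /similar_to /= conjumx //; set T := _ *m invmx S => Ttrig.
have TS : T *m S = S *m Cx M by rewrite /T mulmxKV.
have [i|d [eta [eta0 d0 dT]]] := trig_dissipative Ttrig.
  apply: Mhur; rewrite eigenvalue_root_char -(char_poly_conj _ (mulmxV Sunit)).
  by rewrite char_poly_trig // /root horner_prod (bigD1 i) //= hornerXsubC subrr
    mul0r.
pose D := diag_mx (\row_i d i); pose Sr := map_mx (@complex.Re R) S.
pose Si := map_mx (@complex.Im R) S.
pose P := Sr^T *m D *m Sr + Si^T *m D *m Si.
have bilE (v u : 'cV[R]_n.+1) : (v^T *m P *m u) 0 0 =
    \sum_i d i * redot ((S *m Cx v) i 0) ((S *m Cx u) i 0).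
  have diagE (x y : 'cV[R]_n.+1) : (x^T *m D *m y) 0 0
    = \sum_i d i * (x i 0 * y i 0).
    rewrite mxE; apply: eq_bigr => i _.
    by rewrite mul_mx_diag !mxE mulrA (mulrC (d i)).
  have -> : v^T *m P *m u = (Sr *m v)^T *m D *m (Sr *m u)
      + (Si *m v)^T *m D *m (Si *m u).
    by rewrite /P mulmxDr mulmxDl !trmx_mul !mulmxA.
  rewrite mxE !diagE -big_split; apply: eq_bigr => i _ /=.
  by rewrite -mulrDr -!Re_mulmx -!Im_mulmx !mxE.
have Psym : P^T = P.
  by rewrite /P linearD /= !trmx_mul !trmxK !tr_diag_mx !mulmxA.
have Sv0 (v : 'cV[R]_n.+1) : v != 0 -> S *m Cx v != 0.
  apply: contraNneq => /(congr1 (mulmx (invmx S))).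
  rewrite mulKmx // mulmx0 => /colP Cv0; apply/eqP/colP => i.
  by have := Cv0 i; rewrite !mxE => /eqP;
    rewrite eq_complex /= eqxx andbT => /eqP.
exists P; [|split]; first split=> // v v0; last move=> v v0.
- by rewrite /quad bilE weighted_redot_gt0 // Sv0.
- by rewrite linearN /= linearD /= !trmx_mul trmxK Psym addrC.
rewrite quadN oppr_gt0 quadD.
have -> : quad (M^T *m P) v = quad (P *m M) v.
  by rewrite -quad_trmx trmx_mul trmxK Psym.
have -> : quad (P *m M) v = (v^T *m P *m (M *m v)) 0 0 by rewrite /quad !mulmxA.
rewrite -mulr2n pmulrn_llt0 // bilE.
have -> : S *m Cx (M *m v) = T *m (S *m Cx v).
  by rewrite map_mxM !mulmxA TS.
apply: le_lt_trans (dT _) _; rewrite mulNr oppr_lt0 mulr_gt0 //.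
have := @weighted_redot_gt0 _ (fun=> 1) _ (fun=> ltr01) (Sv0 _ v0).
by under eq_bigr do rewrite mul1r.
Qed.

End Lyapunov.

(** * Solvability of the Riccati inequality *)

Lemma quad_lyap (R : realType) n (P X : 'M[R]_n) v : P^T = P ->
  quad (X^T *m P + P *m X) v = 2 * quad (P *m X) v.
Proof.
move=> Psym; rewrite quadD; have -> : quad (X^T *m P) v = quad (P *m X) v.
  by rewrite -quad_trmx trmx_mul trmxK Psym.
by rewrite mulr_natl mulr2n.
Qed.

Lemma posdef_inv_sym (R : realType) m (W : 'M[R]_m) :
  posdef W -> (invmx W)^T = invmx W.
Proof. by case=> Wsym _; rewrite trmx_inv Wsym. Qed.

Lemma quad_vecD (R : realType) n (S : 'M[R]_n) x y : S^T = S ->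
  quad S (x + y) = quad S x + 2 * (x^T *m S *m y) 0 0 + quad S y.
Proof.
move=> Ssym; have trE (M : 'M[R]_1) : M 0 0 = M^T 0 0 by rewrite mxE.
have yx : (y^T *m S *m x) 0 0 = (x^T *m S *m y) 0 0.
  by rewrite trE !trmx_mul trmxK Ssym mulmxA.
have addE (M M' : 'M[R]_1) : (M + M') 0 0 = M 0 0 + M' 0 0 by rewrite mxE.
rewrite /quad; have -> : (x + y)^T = x^T + y^T by rewrite linearD.
by rewrite (_ : ord0 = 0) // [(_ + _) *m S]mulmxDl mulmxDl !mulmxDr !addE yx;
  ring.
Qed.

Section Riccati.
Variables (R : realType) (n m : nat) (A : 'M[R]_n) (B : 'M[R]_(n, m)).
Variables (Q : 'M[R]_n) (W : 'M[R]_m).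
Hypotheses (Qsym : Q^T = Q) (Wpos : posdef W).

(** The gain term as a Gram matrix: its form is nonnegative, and c^2 times it is
    K^T W K. *)
Lemma gain_gram (P : 'M[R]_n) : P^T = P ->
  P *m B *m invmx W *m B^T *m P =
  (invmx W *m B^T *m P)^T *m W *m (invmx W *m B^T *m P).
Proof.
move=> Psym; rewrite !trmx_mul trmxK Psym posdef_inv_sym // !mulmxA.
by rewrite mulmxKV // posdef_unit.
Qed.

Lemma gain_gram_sym (P : 'M[R]_n) : P^T = P ->
  (P *m B *m invmx W *m B^T *m P)^T = P *m B *m invmx W *m B^T *m P.
Proof.
move=> Psym; rewrite gain_gram //; move: (invmx W *m B^T *m P) => X.
by rewrite !trmx_mul trmxK Wpos.1 mulmxA.
Qed.

(** Let P_0 be a Lyapunov matrix for A + B F and P = tau P_0. For every vector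
    v, with w = W^-1 B^T P_0 v and f = F v, the inequality
    0 <= (r tau w + f)^T W (r tau w + f) bounds the indefinite cross term
    - 2 w^T W f by r tau w^T W w + f^T W f / (r tau). After division by tau
    there remains the Lyapunov form plus the form of (F^T W F / r + q Q) / tau,
    which is negative for large tau. *)
Lemma riccati_solvable (r q : R) : stabilizable A B -> 0 < r ->
  exists2 P, posdef P &
    negdef (A^T *m P + P *m A + (- r) *: (P *m B *m invmx W *m B^T *m P)
            + q *: Q).
Proof.
move=> [F /lyapunov[P0 P0pos Ly]] r0.
pose S := r^-1 *: (F^T *m W *m F) + q *: Q.
have Ssym : S^T = S.
  by rewrite linearD /= !linearZ /= !trmx_mul trmxK Qsym Wpos.1 mulmxA.
have [del del0 LyS] := posdef_perturb Ly Ssym.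
have P0sym := P0pos.1.
pose P := del^-1 *: P0.
have Psym : P^T = P by rewrite linearZ /= P0sym.
have PE : P = del^-1 *: P0 by []; clearbody P.
exists P; [|split]; first split=> // v v0; last move=> v v0.
- by rewrite PE quadZ mulr_gt0 ?invr_gt0 // P0pos.2.
- rewrite linearN /= !linearD /= !linearZ /= gain_gram_sym // !trmx_mul trmxK.
  by rewrite Psym Qsym; congr (_ + _ + _); rewrite addrC.
pose w := invmx W *m B^T *m P0 *m v; pose f := F *m v.
pose wWf := (w^T *m W *m f) 0 0.
have cross : quad (P0 *m (B *m F)) v = wWf.
  rewrite /quad /wWf /w /f !trmx_mul trmxK P0sym posdef_inv_sym // !mulmxA.
  by rewrite mulmxKV ?posdef_unit.
have square : quad W (r / del *: w + f) =
    (r / del) ^+ 2 * quad W w + 2 * (r / del) * wWf + quad W f.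
  rewrite quad_vecD ?Wpos.1 // quad_vecZ.
  have -> : (r / del *: w)^T = r / del *: w^T by rewrite linearZ.
  by rewrite -!scalemxAl [X in 2 * X]mxE -/wWf; ring.
have := posdef_ge0 (r / del *: w + f) Wpos; rewrite square => H2.
have H1 := LyS.2 v v0.
rewrite quadD !quadN quadZ quad_lyap // mulmxDr quadD cross in H1.
rewrite quadD !quadZ quad_congr -/f in H1.
rewrite quadN oppr_gt0 quadD !quadZ quadD quad_lyap // quadZ.
have -> : P *m A = del^-1 *: (P0 *m A) by rewrite PE -scalemxAl.
have -> : quad (P *m B *m invmx W *m B^T *m P) v = del^-1 ^+ 2 * quad W w.
  by rewrite gain_gram // quad_congr -quad_vecZ PE -scalemxAr -!scalemxAl.
rewrite quadZ.
have {}H1 := mulr_gt0 (etrans (invr_gt0 del) del0) H1.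
have {}H2 := mulr_ge0 (etrans (invr_ge0 r) (ltW r0)) H2.
rewrite -oppr_gt0.
set X := (X in 0 < X); set Y := (X in is_true (0 < X)) in H1;
  set Z := (X in is_true (0 <= X)) in H2.
suff -> : X = Y + Z by rewrite ltr_pwDl.
by rewrite /X /Y /Z; field; rewrite !lt0r_neq0.
Qed.
End Riccati.

(** * Spectrum of the Laplacian of a connected graph *)

Section Laplacian.
Variables (R : realType) (N : nat) (e : rel 'I_N).
Hypotheses (e_sym : symmetric e) (e_conn : connected_graph e).
Local Notation L := (laplacian R e).

Lemma laplacian_sym : L^T = L.
Proof.
rewrite linearB /= tr_diag_mx; congr (_ - _).
by apply/matrixP => i j; rewrite !mxE e_sym.
Qed.

Lemma laplacian_mulE (v : 'cV[R]_N) i :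
  (L *m v) i 0 = \sum_j (e i j)%:R * (v i 0 - v j 0).
Proof.
under eq_bigr do rewrite mulrBr.
rewrite sumrB -mulr_suml mulmxBl mxE mul_diag_mx !mxE.
congr (_ * _ - _); last by apply: eq_bigr => j _; rewrite mxE.
by rewrite -sum1_card natr_sum big_mkcond; apply: eq_bigr => j _; rewrite inE;
  case: (e i j).
Qed.

Lemma laplacian_ones : L *m const_mx 1 = 0 :> 'cV[R]_N.
Proof.
apply/colP => i; rewrite laplacian_mulE [RHS]mxE big1 // => j _.
by rewrite !mxE subrr mulr0.
Qed.

Lemma quad_laplacian (v : 'cV[R]_N) :
  2 * quad L v = \sum_i \sum_j (e i j)%:R * (v i 0 - v j 0) ^+ 2.
Proof.
have E : quad L v = \sum_i \sum_j (e i j)%:R * (v i 0 * (v i 0 - v j 0)).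
  rewrite /quad -mulmxA mxE; apply: eq_bigr => i _.
  rewrite laplacian_mulE mxE mulr_sumr; apply: eq_bigr => j _.
  by rewrite mulrCA.
rewrite mulr_natl mulr2n {2}E exchange_big {1}E -big_split;
  apply: eq_bigr => i _ /=.
rewrite -big_split; apply: eq_bigr => j _ /=.
by rewrite (e_sym j i); ring.
Qed.

Lemma quad_laplacian_ge0 v : 0 <= quad L v.
Proof.
have : 0 <= 2 * quad L v.
  rewrite quad_laplacian; do 2!(apply: sumr_ge0 => ? _).
  by rewrite mulr_ge0 ?sqr_ge0.
by rewrite pmulr_rge0.
Qed.

Lemma quad_laplacian_eq0 v : quad L v = 0 -> forall i j, v i 0 = v j 0.
Proof.
move=> Lv0 i j; have : 2 * quad L v = 0 by rewrite Lv0 mulr0.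
have term_ge0 k l : 0 <= (e k l)%:R * (v k 0 - v l 0) ^+ 2
  by rewrite mulr_ge0 ?sqr_ge0.
have sum_ge0 k : 0 <= \sum_l (e k l)%:R * (v k 0 - v l 0) ^+ 2
  by rewrite sumr_ge0.
rewrite quad_laplacian => /(psumr_eq0P (fun k _ => sum_ge0 k)) sum0.
have edge k l : e k l -> v k 0 = v l 0.
  move=> ekl; have /(_ l isT)/eqP :=
    psumr_eq0P (fun l _ => term_ge0 k l) (sum0 k isT).
  by rewrite ekl mul1r sqrf_eq0 subr_eq0 => /eqP.
have /connectP[p + ->] := e_conn i j.
elim: p i => [|k p IHp] i //= /andP[/edge -> /IHp ->] //.
Qed.

(** The eigenvectors for 0 are constant because the graph is connected, and two
    nonzero constant vectors are never orthogonal, so 0 is a simple eigenvalue;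
    it is the smallest because the form of L is nonnegative. Every other d_k is
    an entry of lam of index at least 1. *)
Lemma laplacian_spectrum (lam : N.-tuple R) : (2 <= N)%N ->
  ordered_spectrum L lam ->
  0 < lam`_1 /\
  exists (U : 'M[R]_N) (d : 'rV[R]_N),
   [/\ U^T *m U = 1%:M, U *m U^T = 1%:M, L = U^T *m diag_mx d *m U &
    forall k, (d 0 k = 0 /\ forall i j, U k i = U k j) \/
      lam`_1 <= d 0 k <= lam`_N.-1 ].
Proof.
move=> N2 [lam_sorted charL].
have [U [d [UU UU' LE]]] := sym_orthogonal_diag laplacian_sym.
have Uk k : U *m (row k U)^T = delta_mx k 0.
  by rewrite tr_row colE mulmxA UU' mul1mx.
have quad_row k : quad L (row k U)^T = d 0 k.
  rewrite LE quad_congr Uk quad_diag (bigD1 k) //= big1 => [|i ik].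
    by rewrite !mxE !eqxx expr1n mulr1 addr0.
  by rewrite !mxE (negbTE ik) expr0n mulr0.
have d_ge0 k : 0 <= d 0 k by rewrite -quad_row quad_laplacian_ge0.
have row_const k : d 0 k = 0 -> forall i j, U k i = U k j.
  move=> dk i j; have := quad_row k; rewrite dk => /quad_laplacian_eq0/(_ i j).
  by rewrite !mxE.
have d_inj0 i j : d 0 i = 0 -> d 0 j = 0 -> i = j.
  move=> /row_const Ui /row_const Uj; apply/eqP/negPn/negP => ij.
  have UUE k l : (forall x y, U k x = U k y) -> (forall x y, U l x = U l y) ->
      (U *m U^T) k l = U k i * U l i *+ N.
    move=> Uk_const Ul_const; rewrite mxE;
      transitivity (\sum_(x < N) U k i * U l i).
      by apply: eq_bigr => x _; rewrite !mxE (Uk_const x i) (Ul_const x i) //.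
    by rewrite sumr_const card_ord.
  have := UUE i j Ui Uj; have := UUE j j Uj Uj; have := UUE i i Ui Ui.
  rewrite UU' !mxE !eqxx (negbTE ij) => Uii Ujj /eqP.
  rewrite eq_sym mulrn_eq0 mulf_eq0 => /orP[/eqP N0|/orP[]/eqP U0].
  - by move: N2; rewrite N0.
  - by move/eqP: Uii; rewrite U0 mul0r mul0rn oner_eq0.
  - by move/eqP: Ujj; rewrite U0 mul0r mul0rn oner_eq0.
have charLE : char_poly L = \prod_k ('X - (d 0 k)%:P).
  rewrite LE char_poly_conj // char_poly_trig ?diag_mx_is_trig //.
  by apply: eq_bigr => k _; rewrite mxE eqxx.
have d_lam k : d 0 k \in lam.
  rewrite -root_prod_XsubC -charL charLE /root horner_prod (bigD1 k) //=.
  by rewrite hornerXsubC subrr mul0r.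
have lam_d l : l \in lam -> exists k, l = d 0 k.
  rewrite -root_prod_XsubC -charL charLE /root horner_prod => /prodf_eq0[k _].
  by rewrite hornerXsubC subr_eq0 => /eqP ->; exists k.
have lam_le i j : (i <= j < N)%N -> lam`_i <= lam`_j.
  move=> /andP[ij jN]; rewrite (sorted_leq_nth le_trans le_refl) ?inE
    ?size_tuple //.
  exact: leq_ltn_trans jN.
have [k0 dk0] : exists k, d 0 k = 0.
  suff /existsP[k /eqP dk] : [exists k, d 0 k == 0] by exists k.
  apply: contraPT laplacian_ones => /existsPn d_neq0 L1.
  have : diag_mx d *m (U *m const_mx 1 : 'cV_N) = 0.
    by rewrite -[RHS](mulmx0 _ U) -L1 LE !mulmxA UU' mul1mx.
  move=> /colP dU0.
  have U1 : U *m const_mx 1 = 0 :> 'cV_N.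
    apply/colP => k; have /eqP := dU0 k;
      rewrite mul_diag_mx mxE [in X in _ == X]mxE.
    by rewrite mulf_eq0 (negbTE (d_neq0 k)) /= => /eqP ->; rewrite mxE.
  have : const_mx 1 = 0 :> 'cV[R]_N by rewrite -[LHS]mul1mx -UU -mulmxA U1
    mulmx0.
  move=> /colP/(_ (Ordinal (ltnW N2)))/eqP; rewrite !mxE; exact/negP/oner_neq0.
have lam_ge0 i : (i < N)%N -> 0 <= lam`_i.
  move=> iN; have [|k ->] := @lam_d lam`_i; last exact: d_ge0.
  by rewrite mem_nth ?size_tuple.
have lam0 : lam`_0 = 0.
  apply: le_anti; rewrite lam_ge0 ?andbT; last exact: ltnW.
  have := d_lam k0; rewrite dk0 => /(nthP 0); case=> i;
    rewrite size_tuple => iN lami.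
  by have := lam_le 0 i iN; rewrite lami.
(* If lam`_1 vanished, 'X^2 would divide the characteristic polynomial; after
   cancelling the factor of index k0, another d_k would vanish. *)
have lam1 : 0 < lam`_1.
  rewrite lt0r lam_ge0 // andbT; apply/eqP => lam1.
  have : \prod_(l <- lam) ('X - l%:P) = \prod_k ('X - (d 0 k)%:P)
    by rewrite -charL.
  case: (tval lam) (size_tuple lam) lam0 lam1 => [|x [|y s]] /=;
    try by move=> sz; rewrite -sz in N2.
  move=> _ -> ->; rewrite !big_cons (bigD1 k0) //= dk0 !subr0.
  move=> /(mulfI (negbT (polyX_eq0 R))) /(congr1 (horner^~ 0)).
  rewrite hornerM hornerX mul0r horner_prod => /esym/eqP/prodf_eq0[k kk0].
  rewrite hornerXsubC subr_eq0 eq_sym => /eqP dk.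
  by move: kk0; rewrite (d_inj0 _ _ dk dk0) eqxx.
split=> //; exists U, d; split=> // k.
have /(nthP 0) := d_lam k; case=> -[|i]; rewrite size_tuple => iN dk.
  by left; rewrite -dk lam0; split=> //; apply: row_const; rewrite -dk lam0.
right; rewrite -dk !lam_le //.
by apply/andP; split; lia.
Qed.

Lemma centering_mulE (v : 'rV[R]_N) j :
  (v *m centering R N) 0 j = v 0 j - N%:R^-1 * \sum_i v 0 i.
Proof.
rewrite mulmxBr mulmx1 -scalemxAr mulmxA !mxE big_ord1 !mxE mulr1.
by congr (_ - _ * _); apply: eq_bigr => i _; rewrite mxE mulr1.
Qed.

(** L and the centering matrix are diagonal in the same orthonormal basis: rows
    of U with d_k = 0 are constant and are annihilated by the centering, the
    others are orthogonal to the constants and are fixed by it. *)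
Lemma laplacian_centering_modes (lam : N.-tuple R) : (2 <= N)%N ->
  ordered_spectrum L lam ->
  0 < lam`_1 /\
  exists (U : 'M[R]_N) (d c : 'rV[R]_N),
   [/\ U *m U^T = 1%:M, L = U^T *m diag_mx d *m U,
       centering R N = U^T *m diag_mx c *m U &
    forall k, (d 0 k = 0 /\ c 0 k = 0) \/
      (lam`_1 <= d 0 k <= lam`_N.-1 /\ c 0 k = 1) ].
Proof.
move=> N2 /(laplacian_spectrum N2)[lam1 [U [d [UU UU' LE dP]]]]; split=> //.
exists U, d, (\row_k (d 0 k != 0)%:R); split=> // [|k]; last first.
  rewrite mxE; case: (dP k) => [[-> _]|dk]; first by left; rewrite eqxx.
  by right; rewrite gt_eqF //; case/andP: dk => /(lt_le_trans lam1).
rewrite -mulmxA -[LHS]mul1mx -UU -mulmxA; congr (_ *m _).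
apply/row_matrixP => k; apply/rowP => j.
rewrite row_mul centering_mulE mul_diag_mx !mxE.
have [dk0|dk0] := eqVneq (d 0 k) 0; rewrite ?mul0r ?mul1r.
  have Uk i : U k i = U k j.
    case: (dP k) => [[_ Uk]|/andP[/(lt_le_trans lam1)]]; first exact: Uk.
    by rewrite dk0 ltxx.
  under eq_bigr do rewrite mxE Uk.
  rewrite sumr_const card_ord -[U k j *+ N]mulr_natl mulKf ?subrr //.
  by rewrite pnatr_eq0 -lt0n; exact: ltnW.
have /colP/(_ k)/eqP : diag_mx d *m (U *m const_mx 1 : 'cV_N) = 0.
  by rewrite -[RHS](mulmx0 _ U) -laplacian_ones LE !mulmxA UU' mul1mx.
rewrite mul_diag_mx mxE [in X in _ == X]mxE mulf_eq0 (negbTE dk0) /= mxE =>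
  /eqP U1.
rewrite -[RHS]subr0; congr (_ - _).
rewrite [X in _ * X](_ : _ = 0) ?mulr0 // -[RHS]U1.
by apply: eq_bigr => i _; rewrite !mxE mulr1.
Qed.

End Laplacian.

(** * Kronecker quadratic forms in Laplacian modes *)

Section Kronecker.
Variable R : realType.

Lemma sum_tens (N n : nat) (F : 'I_(N * n) -> R) :
  \sum_x F x = \sum_i \sum_k F (mxtens_index (i, k)).
Proof.
rewrite pair_big (reindex (@mxtens_index N n)) /=; last first.
  by exists (@mxtens_unindex N n) => x _;
    rewrite (mxtens_indexK, mxtens_unindexK).
by apply: eq_bigr => -[i k].
Qed.

Lemma quad_tens_diag N n (d : 'rV[R]_N) (S : 'M[R]_n) y :
  quad (diag_mx d *t S) y = \sum_i d 0 i * quad S (agent y i).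
Proof.
rewrite /quad mxE sum_tens; apply: eq_bigr => i _.
rewrite mxE mulr_sumr; apply: eq_bigr => k _.
rewrite !mxE mulrA mulr_sumr; congr (_ * _).
rewrite sum_tens (bigD1 i) //= [X in _ + X]big1 ?addr0 => [|j ji].
  apply: eq_bigr => l _; rewrite !mxE !mxtens_indexK /= eqxx mulr1n.
  by rewrite mulrCA.
apply: big1 => l _; rewrite !mxE !mxtens_indexK /= (negbTE ji) mulr0n mul0r
  mulr0 //.
Qed.

(** The component of the network state along the k-th row of U; the factor
    1%:M leaves the internal coordinates of the agents alone. *)
Definition mode N n (U : 'M[R]_N) (x : 'cV[R]_(N * n)) (k : 'I_N) : 'cV[R]_n :=
  agent ((U *t 1%:M) *m x) k.

Lemma quad_tens_modes N n (U : 'M[R]_N) (d : 'rV[R]_N) (S : 'M[R]_n) x :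
  quad ((U^T *m diag_mx d *m U) *t S) x = \sum_k d 0 k * quad S (mode U x k).
Proof.
rewrite -quad_tens_diag -quad_congr trmx_tens trmx1 !tensmx_mul.
by rewrite mul1mx mulmx1.
Qed.

Lemma mul_modes N (U : 'M[R]_N) (c d : 'rV[R]_N) : U *m U^T = 1%:M ->
  (U^T *m diag_mx c *m U) *m (U^T *m diag_mx d *m U) =
  U^T *m diag_mx (\row_k (c 0 k * d 0 k)) *m U.
Proof.
move=> UU; rewrite !mulmxA -(mulmxA _ U) UU mulmx1 -(mulmxA U^T).
by rewrite mulmx_diag.
Qed.

(** Minimizing the nonnegative polynomial t |-> quad P (v - t P v) shows that
    |P v|^2 = 0; the value of t is taken with b + 1 instead of b = quad P (P v),
    so that the denominator cannot vanish. *)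
Lemma possemidef_ker n (P : 'M[R]_n) v :
  possemidef P -> quad P v = 0 -> P *m v = 0.
Proof.
case=> Psym P0 Pv0; pose w := P *m v.
have aE : quad 1%:M w = (v^T *m P *m w) 0 0.
  by rewrite /quad mulmx1 {1}/w trmx_mul Psym.
have b0 := P0 w; set b := quad P w in b0.
have := P0 (v + - (quad 1%:M w / (b + 1)) *: w).
rewrite quad_vecD // Pv0 quad_vecZ -scalemxAr mxE -aE add0r -/b.
have b10 : b + 1 != 0 by rewrite lt0r_neq0 // ltr_wpDl.
have -> : 2 * (- (quad 1%:M w / (b + 1)) * quad 1%:M w) +
    (- (quad 1%:M w / (b + 1))) ^+ 2 * b =
    - (quad 1%:M w ^+ 2 * ((b + 2) / (b + 1) ^+ 2)) by field.
rewrite oppr_ge0 pmulr_lle0; last by rewrite divr_gt0 ?exprn_gt0 ?ltr_wpDl.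
move=> w0; apply/eqP; rewrite -quad1_eq0 -sqrf_eq0 eq_le w0.
exact: sqr_ge0.
Qed.

End Kronecker.

(** On a vector killed by P the Riccati form reduces to lamN * quad Q v, which
    is not negative. *)
Lemma riccati_posdef (R : realType) n m (A : 'M[R]_n) (B : 'M[R]_(n, m))
    (Q : 'M[R]_n) (W : 'M[R]_m) (c lam2 lamN : R) (P : 'M[R]_n) :
  possemidef Q -> possemidef P -> 0 <= lamN ->
  riccati_ineq A B Q W c lam2 lamN P -> posdef P.
Proof.
move=> Q0 P0 lam0 [_ ric]; split=> [|v v0]; first exact: P0.1.
rewrite lt0r (P0.2 v) andbT; apply/eqP => Pv0; have := ric v v0.
have Pv := possemidef_ker P0 Pv0.
have PX0 (X : 'M[R]_n) : quad (P *m X) v = 0.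
  rewrite /quad; have -> : v^T *m (P *m X) *m v = (P *m v)^T *m (X *m v).
    by rewrite trmx_mul P0.1 !mulmxA.
  by rewrite Pv trmx0 mul0mx mxE.
rewrite quadN oppr_gt0 quadD quadD quad_lyap; last exact: P0.1.
rewrite !quadZ -!mulmxA !PX0 !mulr0 !add0r ltNge.
by rewrite mulr_ge0 // Q0.2.
Qed.

(** * Dissipation of the disagreement *)

Section Dissipation.
Variables (R : realType) (N n m : nat) (A : 'M[R]_n) (B : 'M[R]_(n, m)).
Variables (Q : 'M[R]_n) (W : 'M[R]_m) (L : 'M[R]_N).
Variables (U : 'M[R]_N) (d e : 'rV[R]_N) (lam2 lamN c : R) (P : 'M[R]_n).
Hypotheses (Q0 : possemidef Q) (Wpos : posdef W) (P0 : possemidef P).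
Hypotheses (UU : U *m U^T = 1%:M) (LE : L = U^T *m diag_mx d *m U).
Hypothesis CE : centering R N = U^T *m diag_mx e *m U.
Hypothesis modesP : forall k, (d 0 k = 0 /\ e 0 k = 0) \/
  (lam2 <= d 0 k <= lamN /\ e 0 k = 1).
Hypotheses (lam2_gt0 : 0 < lam2) (lam2N : lam2 <= lamN).
Hypotheses (c_gt0 : 0 < c) (c_lt : c < 2 / (lam2 + lamN)).
Hypothesis ric : riccati_ineq A B Q W c lam2 lamN P.

Local Notation K := (- c *: (invmx W *m B^T *m P)).
Local Notation C := (centering R N).
Local Notation M := (closed_loop A B L K).
Local Notation costmx := (L *t Q + (L *m L) *t (K^T *m W *m K)).
Local Notation z := (mode U).

Let g (v : 'cV[R]_n) : R := quad W (invmx W *m B^T *m P *m v).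

Let quad_gain v : quad (P *m (B *m K)) v = - c * g v.
Proof.
by rewrite -!scalemxAr quadZ !mulmxA gain_gram ?quad_congr //; case: P0.
Qed.

Let quad_costmx x :
  quad costmx x =
    \sum_k (d 0 k * quad Q (z x k) + c ^+ 2 * d 0 k ^+ 2 * g (z x k)).
Proof.
rewrite quadD LE mul_modes // !quad_tens_modes -big_split;
  apply: eq_bigr => k _ /=.
congr (_ + _); rewrite quad_congr -scalemxAl quad_vecZ mxE sqrrN -/(g _); ring.
Qed.

Lemma quad_costmx_ge0 x : 0 <= quad costmx x.
Proof.
rewrite quad_costmx sumr_ge0 // => k _.
have d0 : 0 <= d 0 k.
  case: (modesP k) => [[-> _] //|[/andP[+ _] _]].
  by apply: le_trans; exact: ltW.
have gk : 0 <= g (z x k) by exact: posdef_ge0.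
apply: addr_ge0; first by rewrite mulr_ge0 // Q0.2.
by rewrite !mulr_ge0 // ?exprn_ge0 // ltW.
Qed.

Let Csym : C^T = C.
Proof. by rewrite CE !trmx_mul trmxK tr_diag_mx mulmxA. Qed.

Let CtPsym : (C *t P)^T = C *t P.
Proof. by rewrite trmx_tens Csym P0.1. Qed.

Let quad_derivative x :
  quad (M^T *m (C *t P) + (C *t P) *m M) x =
  \sum_k 2 * (e 0 k * quad (P *m A) (z x k) - c * d 0 k * g (z x k)).
Proof.
rewrite quad_lyap; last exact: CtPsym.
rewrite mulmxDr !tensmx_mul mulmx1 CE LE mul_modes // -CE.
rewrite quadD [in X in X + _]CE !quad_tens_modes -mulr_sumr -big_split /=.
congr (2 * _); apply: eq_bigr => k _.
rewrite quad_gain mxE.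
by case: (modesP k) => [[-> ->]|[_ ->]]; ring.
Qed.

(** The left-hand side is the derivative of x^T (C (x) P) x along the closed
    loop plus the running cost. Mode by mode it is a Riccati form with d_k in
    place of lam2 in the gain coefficient and of lamN in front of Q; both
    replacements can only decrease it. *)
Lemma dissipation : exists2 kap, 0 < kap & forall x : 'cV[R]_(N * n),
  quad (M^T *m (C *t P) + (C *t P) *m M) x + quad costmx x <=
  - kap * quad (C *t P) x.
Proof.
have [kap kap0 ricP] := posdef_perturb ric P0.1.
exists kap => // x.
rewrite quad_derivative quad_costmx CE quad_tens_modes mulr_sumr -big_split.
apply: ler_sum => k _ /=.
case: (modesP k) => [[-> ->]|[/andP[dl du] ->]].
  by rewrite !(mul0r, mulr0, expr0n, subr0, addr0).
move: (z x k) => v.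
have := posdef_ge0 v ricP.
rewrite quadD !quadN quadZ quadD quadD quad_lyap; last exact: P0.1.
rewrite !quadZ gain_gram //; last exact: P0.1.
rewrite quad_congr -/(g v) => Rv.
have gv : 0 <= g v by exact: posdef_ge0.
have qv : 0 <= quad Q v by exact: Q0.2.
have cl : c * (d 0 k + lam2) <= 2.
  have l0 : 0 < lam2 + lamN by rewrite addr_gt0 // (lt_le_trans lam2_gt0).
  apply: (@le_trans _ _ (c * (lam2 + lamN))).
    by rewrite ler_pM2l // addrC lerD2l.
  by rewrite ltW // -ltr_pdivlMr.
have gain_le : (c ^+ 2 * d 0 k ^+ 2 - 2 * c * d 0 k) * g v <=
    (c ^+ 2 * lam2 ^+ 2 - 2 * c * lam2) * g v.
  apply: ler_wpM2r => //; rewrite -subr_le0.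
  (* The parabola c^2 d^2 - 2 c d is below its value at lam2 for d between
     lam2 and 2 / c - lam2, and the latter exceeds lamN. *)
  have -> : c ^+ 2 * d 0 k ^+ 2 - 2 * c * d 0 k -
     (c ^+ 2 * lam2 ^+ 2 - 2 * c * lam2) = c * ((d 0 k - lam2) * (c * (d 0 k +
       lam2) - 2)) by ring.
  rewrite pmulr_rle0 // mulr_ge0_le0 //; first by rewrite subr_ge0.
  by rewrite subr_le0.
have Q_le : d 0 k * quad Q v <= lamN * quad Q v by apply: ler_wpM2r.
move: (quad (P *m A) v) (quad P v) (quad Q v) (g v) Rv gain_le Q_le =>
  a p q0 g0.
lra.
Qed.

(** C (x) 1 is an orthogonal projection that subtracts the average of the
    agents, so it does not change differences between agents. *)
Lemma agent_diff_le x i j l :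
  (agent x i l 0 - agent x j l 0) ^+ 2 <= 4 * quad (C *t (1%:M : 'M[R]_n)) x.
Proof.
have CC : C^T *m C = C.
  rewrite Csym CE mul_modes //; congr (_ *m diag_mx _ *m _).
  by apply/rowP => k; rewrite mxE; case: (modesP k) => [[_ ->]|[_ ->]]; ring.
pose y := (C *t (1%:M : 'M[R]_n)) *m x.
have -> : quad (C *t (1%:M : 'M[R]_n)) x = quad 1%:M y.
  by rewrite -quad_congr mulmx1 trmx_tens trmx1 tensmx_mul CC mulmx1.
have yE i' : y (mxtens_index (i', l)) 0 =
    agent x i' l 0 - N%:R^-1 * \sum_k agent x k l 0.
  pose v := \row_k agent x k l 0.
  transitivity ((v *m C) 0 i').
    rewrite mxE sum_tens mxE; apply: eq_bigr => k _.
    have Cik : C i' k = C k i' by rewrite -[in LHS]Csym mxE.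
    rewrite (bigD1 l) //= big1 ?addr0 => [|l' l'l].
      by rewrite tensmxE Cik [v _ _]mxE [1%:M _ _]mxE [agent _ _ _ _]mxE eqxx
        mulr1 mulrC.
    by rewrite tensmxE [1%:M _ _]mxE eq_sym (negbTE l'l) mulr0 mul0r.
  rewrite centering_mulE mxE; congr (_ - _ * _).
  by apply: eq_bigr => k _; rewrite mxE.
have y_le i' : y (mxtens_index (i', l)) 0 ^+ 2 <= quad 1%:M y.
  rewrite quad1E (bigD1 (mxtens_index (i', l))) //= lerDl sumr_ge0 // => ? _.
  exact: sqr_ge0.
have -> : agent x i l 0 - agent x j l 0 =
    y (mxtens_index (i, l)) 0 - y (mxtens_index (j, l)) 0.
  by rewrite !yE; ring.
have := y_le i; have := y_le j.
move: (y _ 0) (y _ 0) (quad _ _) => a b q0 ha hb.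
have := sqr_ge0 (a + b); nra.
Qed.

End Dissipation.

(** * Quadratic forms along solutions *)

Section Analysis.
Variable R : realType.

Lemma quadE n (S : 'M[R]_n) v :
  quad S v = \sum_i \sum_j S i j * (v i 0 * v j 0).
Proof.
rewrite /quad -mulmxA mxE; apply: eq_bigr => i _; rewrite !mxE mulr_sumr.
by apply: eq_bigr => j _; rewrite mulrCA.
Qed.

Lemma continuous_quad n (S : 'M[R]_n) : continuous (quad S).
Proof.
have -> : quad S = fun v => \sum_i \sum_j S i j * (v i 0 * v j 0).
  by apply/funext => v; rewrite quadE.
apply: (continuous_big add_continuous) => i _.
apply: (continuous_big add_continuous) => j _ v.
have coordc (k : 'I_n) : (fun w : 'cV[R]_n =>
  w k 0) @ v --> v k 0 by exact: coord_continuous.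
exact: (cvgM (@cvg_cst _ (S i j) _ (nbhs v) _) (cvgM (coordc i) (coordc j))).
Qed.

Lemma is_derive_coord n (x : R -> 'cV[R]_n) (dx : 'cV[R]_n) (t : R) i :
  is_derive t 1 x dx -> is_derive t 1 (fun s => x s i 0) (dx i 0).
Proof.
move=> [dxt <-]; apply: DeriveDef; first by move/derivable_mxP: dxt; exact.
by rewrite derive_mx // mxE.
Qed.

Lemma is_derive_quad n (S M : 'M[R]_n) (x : R -> 'cV[R]_n) (t : R) :
  is_derive t 1 x (M *m x t) ->
  is_derive t 1 (fun s => quad S (x s)) (quad (M^T *m S + S *m M) (x t)).
Proof.
move=> dx.
have -> : (fun s => quad S (x s)) =
    \sum_i \sum_j (fun s => S i j * (x s i 0 * x s j 0)).
  apply/funext => s; rewrite quadE fct_sumE; apply: eq_bigr => i _.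
  by rewrite fct_sumE.
have dij i j : is_derive t 1 (fun s => S i j * (x s i 0 * x s j 0))
    (S i j * ((M *m x t) i 0 * x t j 0 + x t i 0 * (M *m x t) j 0)).
  have di := is_derive_coord i dx; have dj := is_derive_coord j dx.
  have dM : is_derive t 1 ((fun s => x s i 0) * (fun s =>
    x s j 0)) _ := is_deriveM di dj.
  have dZ := is_deriveZ (S i j) dM.
  apply: (is_derive_eq (f := fun s => S i j * (x s i 0 * x s j 0)) dZ).
  by congr (_ * _); rewrite addrC /GRing.scale /= [X in X + _ = _]mulrC.
have dsum := is_derive_sum (fun i => is_derive_sum (fun j => dij i j)).
apply: (is_derive_eq dsum).
rewrite quadD /quad.
have -> : (x t)^T *m (M^T *m S) *m x t = (M *m x t)^T *m (S *m x t).
  by rewrite trmx_mul !mulmxA.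
have -> : (x t)^T *m (S *m M) *m x t = (x t)^T *m (S *m (M *m x t)).
  by rewrite !mulmxA.
rewrite [X in _ = X + _]mxE [X in _ = _ + X]mxE -big_split;
  apply: eq_bigr => i _ /=.
rewrite [(M *m x t)^T _ _]mxE [(x t)^T _ _]mxE [X in _ = _ * X + _]mxE.
rewrite [(S *m (M *m x t)) _ _]mxE !mulr_sumr -big_split;
  apply: eq_bigr => j _ /=.
ring.
Qed.

(** The function t |-> f t * expR (kap * t) is nonincreasing, and expR (kap * t)
    exceeds kap * t. *)
Lemma decay_cvg0 (f : R -> R) (kap : R) : 0 < kap ->
  {within `[0, +oo[, continuous f} ->
  (forall t : R, 0 < t -> derivable f t 1) ->
  (forall t : R, 0 < t -> derive1 f t <= - kap * f t) ->
  (forall t : R, 0 <= t -> 0 <= f t) ->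
  f t @[t --> +oo] --> (0 : R).
Proof.
move=> kap0 fc fd df f0.
pose h t := f t * expR (kap * t).
have hle t : 0 <= t -> h t <= f 0.
  move=> t0; have -> : f 0 = h 0 by rewrite /h mulr0 expR0 mulr1.
  have dh (s : R) : 0 < s -> is_derive s 1 h (derive1 f s * expR (kap * s) + f s
    * (kap * expR (kap * s))).
    move=> s0; have ? := derivableP (fd s s0).
    have dexp : is_derive s 1 (expR \o (fun u =>
      kap * u)) (expR (kap * s) * kap).
      apply: is_derive1_comp.
      apply: (is_derive_eq (f := fun u =>
        kap * u) (is_deriveZ kap (is_derive_id s 1))).
      exact: mulr1.
    apply: (is_derive_eq (f := h) (is_deriveM (derivableP (fd s s0)) dexp)).
    by rewrite derive1E /GRing.scale /=; ring.
  apply: (@ler0_derive1_nincry _ h 0) => // [s|s|].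
  - by rewrite in_itv /= andbT => /dh [].
  - rewrite in_itv /= andbT => s0; rewrite derive1E; have [_ ->] := dh s s0.
    have := df s s0; have := expR_gt0 (kap * s).
    nra.
  - move=> s; apply: cvgM; first exact: fc.
    have ec : continuous (fun u : R => expR (kap * u)).
      by move=> u; apply: continuous_comp;
        [exact: mulrl_continuous|exact: continuous_expR].
    exact: (continuous_subspaceT ec).
apply/cvgrPdist_le => eps eps0; near=> t.
have t0 : 0 < t by near: t; exact: nbhs_pinfty_gt.
have teps : f 0 / (eps * kap) <= t by near: t; apply: nbhs_pinfty_ge;
  exact: num_real.
rewrite sub0r normrN ger0_norm; last exact/f0/ltW.
rewrite ler_pdivrMr ?mulr_gt0 // mulrCA in teps.
have kt0 : 0 < kap * t by rewrite mulr_gt0.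
rewrite -(ler_pM2r kt0).
apply: le_trans (_ : h t <= _).
  rewrite ler_wpM2l ?(f0 _ (ltW t0)) // (le_trans _ (expR_ge1Dx _)) //.
  by rewrite lerDr.
by rewrite (le_trans (hle _ (ltW t0))) // [kap * t]mulrC.
Unshelve. all: by end_near.
Qed.

Lemma within_continuous_quad n (S : 'M[R]_n) (x : R -> 'cV[R]_n) (D : set R) :
  {within D, continuous x} -> {within D, continuous (fun t => quad S (x t))}.
Proof.
move=> xc t; apply: (@continuous_comp _ _ _ (x : subspace D -> _) (quad S));
  first exact: xc.
exact: continuous_quad.
Qed.

(** By the fundamental theorem of calculus on the half-line, V 0 is exactly the
    integral of the dissipation rate G, which dominates F. *)
Lemma dissipated_integral (V F G : R -> R) :
  {within `[0, +oo[, continuous V} -> {within `[0, +oo[, continuous F} ->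
  {within `[0, +oo[, continuous G} ->
  (forall t : R, 0 < t -> is_derive t 1 V (- G t)) ->
  (forall t : R, 0 <= t -> 0 <= F t <= G t) ->
  V t @[t --> +oo] --> (0 : R) ->
  (\int[@lebesgue_measure R]_(t in `[0%R, +oo[) (F t)%:E <= (V 0)%:E)%E.
Proof.
move=> Vc Fc Gc dV FG V0.
have mF (f : R -> R) : {within `[0, +oo[, continuous f} ->
    measurable_fun (`[0, +oo[%classic : set R) f.
  by move=> fc; apply: subspace_continuous_measurable_fun.
have G_ge0 t : 0 <= t -> 0 <= G t.
  by move=> /FG/andP[F0]; exact: le_trans.
have /continuous_within_itvcyP[_ V0r] := Vc.
have -> : (V 0)%:E = (\int[@lebesgue_measure R]_(t in `[0%R, +oo[) (G t)%:E)%E.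
  rewrite (@ge0_continuous_FTC2y R G (fun t => - V t) 0 0) //.
  - by rewrite EFinN oppeK add0e.
  - by rewrite -oppr0; apply: cvgN.
  - by move=> t t0; have dVt := dV t t0; apply: derivableN; case: dVt.
  - by apply: cvgN.
  - move=> t; rewrite in_itv /= andbT => t0; have dVt := dV t t0.
    by rewrite derive1E deriveN ?(derive_val (is_derive := dVt)) ?opprK //;
      case: dVt.
apply: ge0_le_integral => //.
- by move=> t /=; rewrite in_itv /= andbT lee_fin => /FG/andP[].
- by apply/measurable_EFinP; exact: mF.
- by apply/measurable_EFinP; exact: mF.
- by move=> t /=; rewrite in_itv /= andbT lee_fin => /FG/andP[].
Qed.

End Analysis.

(** * Suboptimal consensus *)

Theorem theorem12 (R : realType) (N n m : nat) (hN : (2 <= N)%N)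
    (A : 'M[R]_n) (B : 'M[R]_(n, m)) (hAB : stabilizable A B)
    (x0 : 'cV[R]_(N * n))
    (Q : 'M[R]_n) (hQ : possemidef Q) (W : 'M[R]_m) (hW : posdef W)
    (e : rel 'I_N) (he : simple_undirected e) (hconn : connected_graph e)
    (lam : N.-tuple R) (hlam : ordered_spectrum (laplacian R e) lam)
    (gamma : R) (hgamma : 0 < gamma)
    (c : R) (hc0 : 0 < c) (hc : c < 2 / (lam`_1 + lam`_N.-1)) :
  (exists P : 'M[R]_n,
     possemidef P /\ riccati_ineq A B Q W c lam`_1 lam`_N.-1 P) /\
  (forall P : 'M[R]_n,
     possemidef P ->
     riccati_ineq A B Q W c lam`_1 lam`_N.-1 P ->
     quad (centering R N *t P) x0 < gamma ->
     let K : 'M[R]_(m, n) := - c *: (invmx W *m B^T *m P) in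
     reaches_consensus (closed_loop A B (laplacian R e) K) /\
     suboptimal A B (laplacian R e) Q W x0 gamma K).
Proof.
have [lam1 [U [d [s [UU LE CE modesP]]]]] :=
  laplacian_centering_modes he.1 hconn hN hlam.
have lam1N : lam`_1 <= lam`_N.-1.
  by rewrite (sorted_leq_nth le_trans le_refl) ?inE ?size_tuple ?hlam.1 //; lia.
have lamN : 0 < lam`_N.-1 := lt_le_trans lam1 lam1N.
split.
  (* c * lam2 < 2 makes the coefficient of the gain term negative. *)
  have r0 : 0 < 2 * c * lam`_1 - c ^+ 2 * lam`_1 ^+ 2.
    have -> : 2 * c * lam`_1 - c ^+ 2 * lam`_1 ^+ 2
      = (c * lam`_1) * (2 - c * lam`_1) by ring.
    rewrite mulr_gt0 ?mulr_gt0 // subr_gt0.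
    apply: le_lt_trans (_ : c * (lam`_1 + lam`_N.-1) < 2).
      by rewrite ler_pM2l // lerDl ltW.
    by rewrite -ltr_pdivlMr // addr_gt0.
  have [P Ppos ric] := riccati_solvable hQ.1 hW lam`_N.-1 hAB r0.
  exists P; split.
    by split=> [|v]; [case: Ppos | exact: posdef_ge0].
  by rewrite /riccati_ineq -opprB.
move=> P P0 ric Px0 K.
have Ppos := riccati_posdef hQ P0 (ltW lamN) ric.
have [kap kap0 diss] := dissipation hQ hW P0 UU LE CE modesP lam1 lam1N hc0 hc
  ric.
set L := laplacian R e in diss *; set M := closed_loop A B L K.
pose V := centering R N *t P.
pose S := L *t Q + (L *m L) *t (K^T *m W *m K).
pose DV := M^T *m V + V *m M.
have S_ge0 x : 0 <= quad S x by exact: (quad_costmx_ge0 B P hQ hW UU LE modesP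
  lam1 hc0).
have V_ge0 x : 0 <= quad V x.
  rewrite /V CE quad_tens_modes sumr_ge0 // => k _.
  by case: (modesP k) => [[_ ->]|[_ ->]]; rewrite ?mul0r ?mul1r // P0.2.
have dV x y : is_solution M x y -> forall t : R, 0 < t ->
    is_derive t 1 (fun t : R => quad V (y t)) (quad DV (y t)).
  by case=> _ _ dy t t0; apply: is_derive_quad; exact: dy.
have V_to0 x y : is_solution M x y -> quad V (y t) @[t --> +oo] --> (0 : R).
  move=> sol; have [_ yc _] := sol.
  apply: (decay_cvg0 kap0) => // [|t t0|t t0].
  - exact: within_continuous_quad.
  - by have := dV _ _ sol t t0; case.
  - have dVt := dV _ _ sol t t0; rewrite derive1E derive_val.
    by apply: le_trans (diss (y t)); rewrite lerDl.
split=> [x y sol i j|y sol].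
  have [p p_gt0 Pp] := posdef_coercive Ppos.
  have V_ge z : p * quad (centering R N *t (1%:M : 'M[R]_n)) z <= quad V z.
    rewrite /V CE !quad_tens_modes mulr_sumr; apply: ler_sum => k _.
    by case: (modesP k) => [[_ ->]|[_ ->]]; rewrite ?mul0r ?mulr0 ?mul1r.
  (* p * eps ^+ 2 / 4 is the level of V that keeps every coordinate of the
     difference at most eps, by agent_diff_le and V_ge. *)
  apply/cvgrPdist_le => eps eps0.
  have eps1 : 0 < p * eps ^+ 2 / 4 by rewrite divr_gt0 // mulr_gt0 // exprn_gt0.
  have /cvgrPdist_le/(_ _ eps1) := V_to0 _ _ sol.
  apply: filterS => t; rewrite !sub0r !normrN ger0_norm // => Vt.
  rewrite [leLHS]/Num.Def.normr /= mx_normrE (bigmax_le _ (ltW eps0)) //= =>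
    -[l o] _.
  rewrite ord1 -(ler_pXn2r (n := 2)) ?nnegrE ?(ltW eps0) // real_normK ?num_real
    //.
  have -> : (agent (y t) i - agent (y t) j) l 0
    = agent (y t) i l 0 - agent (y t) j l 0.
    by rewrite [LHS]mxE; congr (_ + _); rewrite [LHS]mxE.
  apply: le_trans (agent_diff_le UU CE modesP _ _ _ _) _.
  have := V_ge (y t); nra.
have [y0 yc _] := sol.
apply: (@le_lt_trans _ _ (quad V (y 0))%:E); last by rewrite y0 lte_fin.
apply: (@dissipated_integral _ (fun t => quad V (y t)) _ (fun t =>
  - quad DV (y t))).
- exact: within_continuous_quad.
- exact: within_continuous_quad.
- under [X in continuous X]eq_fun do rewrite -quadN.
  exact: within_continuous_quad.
- by move=> t t0; rewrite opprK; exact: dV sol t t0.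
- move=> t _; rewrite S_ge0 /= -subr_ge0 -opprD oppr_ge0.
  apply: le_trans (diss (y t)) _.
  by rewrite mulNr oppr_le0 mulr_ge0 // ltW.
- exact: V_to0 sol.
Qed.
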